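(* Let $\mathcal I=\{1,\dots,I\}$ be the set of user equipments (UEs), let the active cluster size be an arbitrary $l\in\mathcal I$ (exactly $l$ UEs transmit in each slot), and suppose the UEs are homogeneous, i.e. their time-varying packet error rates (PERs) are independent and identically distributed over all UEs and all time slots. Then, among all blind schedules $\pi$, $l$-clustered round-robin is an asymptotic optimum that, with arbitrary initial ages $h_i(0)$ for all $i\in\mathcal I$, minimizes $\overline h_\pi^{(T,I)}$ as $T\to+\infty$, i.e. for every blind schedule $\pi$, $\limsup_{T\to\infty}\overline h_{l\text{-RR}}^{(T,I)}\le\liminf_{T\to\infty}\overline h_{\pi}^{(T,I)}$, where $l$-RR denotes $l$-clustered round-robin.
   Context: Time is divided into slots $t=1,2,\dots$ of length $n>0$ (measured in symbol lengths). In each slot $t$ a schedule $\pi$ selects an active cluster $\mathcal I_t\subseteq\mathcal I$ with $|\mathcal I_t|=l$; only UEs in $\mathcal I_t$ attempt a transmission. Each UE $i$ scheduled in slot $t$ has a PER $\varepsilon_i(t)\in[0,1]$; these PERs are random, i.i.d. over all $(i,t)$, with mean $\varepsilon_{\mathrm{avg}}$. The success indicator $s_i(t)\in\{0,1\}$ is Bernoulli with success probability $1-\varepsilon_i(t)$ (independently over $(i,t)$ given the PERs). If $i$ is not scheduled in slot $t$, then by convention $\varepsilon_i(t)=1$, so $s_i(t)=0$. Every UE always sends a fresh message when scheduled, so the age of information (AoI) $h_i(t)$ of UE $i$ at the end of slot $t$ evolves, from the initial value $h_i(0)$, as $$h_i(t)=\begin{cases} n & \text{if } s_i(t)=1,\\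 h_i(t-1)+n & \text{otherwise.}\end{cases}$$ A schedule is blind if the selection $\mathcal I_t$ in each slot $t$ is a function only of the past selections $\mathcal I_1,\dots,\mathcal I_{t-1}$ and of long-term average channel statistics (the constant $\varepsilon_{\mathrm{avg}}$); in particular it does not depend on the AoI values, on transmission outcomes, or on the realized PERs. $l$-clustered round-robin is the blind schedule that in every slot selects the $l$ UEs with the longest interval since their last transmission attempt (whether successful or not); UEs that have not yet transmitted are considered to have the longest interval, and ties are broken arbitrarily. $\mathbb E_\pi$ denotes expectation when schedule $\pi$ is used, and $$\overline h_\pi^{(T,I)}=\mathbb E_\pi\left(\frac{1}{IT}\sum_{t=1}^{T}\sum_{i\in\mathcal I}h_i(t)\right).$$
   Formalization: Ties are not broken arbitrarily: between UEs with equal intervals but different past attempts, the one whose turn it is goes first (cyclic service). This is automatic if l divides I; otherwise arbitrary tie-breaking can be suboptimal, e.g. I=3, l=2, always favouring UE 1. *)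

(* Defs.v *)
From HB Require Import structures.
From mathcomp Require Export all_boot all_order all_algebra.
From mathcomp Require Export all_classical all_reals all_analysis.

Set Implicit Arguments.
Unset Strict Implicit.
Unset Printing Implicit Defensive.

Export Order.TTheory GRing.Theory Num.Theory.
Export numFieldNormedType.Exports.

Local Open Scope classical_set_scope.
Local Open Scope ring_scope.

(** Conventions.  The [N] UEs are the elements of ['I_N].  Slots are the
    integers [t >= 1]; values of slot-indexed families at [t = 0] are junk and
    never used, except [aoi _ _ _ _ 0], the initial age. *)

(** A blind schedule maps the long-term average PER and the list of past
    selections [:: I_1; ...; I_(t-1)] to the selection I_t; the slot index is
    available to it as the length of that list plus one. *)
Definition blind_schedule (R : realType) (N : nat) : Type :=
  R -> seq {set 'I_N} -> {set 'I_N}.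

Section Schedules.
Context (R : realType) (N : nat) (eavg : R).
Implicit Types (pi : blind_schedule R N) (i j : 'I_N) (l t u v : nat).

Fixpoint selections pi t : seq {set 'I_N} :=
  if t is t'.+1 then
    rcons (selections pi t') (pi eavg (selections pi t'))
  else [::].

Definition active pi t : {set 'I_N} := pi eavg (selections pi t.-1).

Definition cluster_size l pi : Prop :=
  forall t, (0 < t)%N -> #|active pi t| = l.

(** [0] if [i] has not attempted any transmission before slot [t]. *)
Definition last_attempt pi i t : nat :=
  (\max_(u < t | (0 < u) && (i \in active pi u)) u)%N.

(** A UE that has not yet transmitted gets the value [t], which exceeds that of
    every UE that has. *)
Definition interval_since_attempt pi i t : nat := (t - last_attempt pi i t)%N.

Definition clustered_round_robin l pi : Prop :=
  cluster_size l pi /\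
  forall t i j, (0 < t)%N -> i \in active pi t -> j \notin active pi t ->
    (interval_since_attempt pi j t <= interval_since_attempt pi i t)%N.

(** Round-robin service is cyclic: UEs take turns.  When a tie between [i] and
    [j] is resolved in favour of [i], the last earlier slot (if any) that told
    them apart, i.e. in which exactly one of them attempted, was an attempt of
    [j].  A tie between UEs with the same attempts so far is unrestricted, and
    so the cyclic order is arbitrary.  The condition holds automatically when
    [l] divides [N] (in particular for [l = 1]).  Otherwise, some such rule is
    needed for optimality: for N = 3 and l = 2, resolving every tie in favour
    of the smallest index activates {1,2}, {1,3}, {1,2}, {1,3}, ... (UE 1 is
    served in every slot), whose limiting average age is n(4+e)/(3(1-e)),
    whereas {1,2}, {3,1}, {2,3}, {1,2}, ... achieves
    n(4+4e+e^2)/(3(1-e)(1+e)), strictly less for an average PER 0 < e < 1. *)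
Definition ties_by_turns pi : Prop :=
  forall t i j, (0 < t)%N -> i \in active pi t -> j \notin active pi t ->
    interval_since_attempt pi i t = interval_since_attempt pi j t ->
    forall u, (0 < u < t)%N ->
      (i \in active pi u) != (j \in active pi u) ->
      (forall v, (u < v < t)%N -> (i \in active pi v) = (j \in active pi v)) ->
      j \in active pi u.

End Schedules.

Section Channel.
Context (R : realType) (N : nat) (d : measure_display) (T : measurableType d)
  (P : probability T R).
Local Open Scope ereal_scope.

Definition mutually_independent (per : 'I_N -> nat -> {RV P >-> R}) : Prop :=
  forall (J : seq ('I_N * nat)) (B : 'I_N * nat -> set R),
    uniq J -> (forall k, k \in J -> (0 < k.2)%N) ->
    (forall k, measurable (B k)) ->
    P (\bigcap_(k in [set` J]) per k.1 k.2 @^-1` B k) =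
      \prod_(k <- J) P (per k.1 k.2 @^-1` B k).

Definition identically_distributed (per : 'I_N -> nat -> {RV P >-> R}) : Prop :=
  forall (i j : 'I_N) (t u : nat) (B : set R),
    (0 < t)%N -> (0 < u)%N -> measurable B ->
    P (per i t @^-1` B) = P (per j u @^-1` B).

Definition iid_per (eavg : R) (per : 'I_N -> nat -> {RV P >-> R}) : Prop :=
  [/\ forall i t w, (0 < t)%N -> (0 <= per i t w <= 1)%R,
      mutually_independent per,
      identically_distributed per &
      forall i t, (0 < t)%N -> 'E_P[per i t] = eavg%:E].

Definition sigma_per (per : 'I_N -> nat -> {RV P >-> R}) : set (set T) :=
  <<s [set A | exists (i : 'I_N) (t : nat) (B : set R),
         [/\ (0 < t)%N, measurable B & A = per i t @^-1` B]] >>.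

(** The PER with the convention that it is 1 when the UE is not scheduled. *)
Definition scheduled_per (eavg : R) (per : 'I_N -> nat -> {RV P >-> R})
    (pi : blind_schedule R N) (i : 'I_N) (t : nat) (w : T) : R :=
  if i \in active eavg pi t then per i t w else 1%R.

(** Under [pi], conditionally on all the PERs, the indicators [s i t] are
    independent Bernoulli variables with success probability
    [1 - scheduled_per i t].  The conditional law given the sigma-algebra of the
    PERs is specified by its defining property on the events [A] of that
    sigma-algebra. *)
Definition success_indicators (eavg : R) (per : 'I_N -> nat -> {RV P >-> R})
    (pi : blind_schedule R N) (s : 'I_N -> nat -> {RV P >-> bool}) : Prop :=
  forall (J : seq ('I_N * nat)) (b : 'I_N * nat -> bool) (A : set T),
    uniq J -> (forall k, k \in J -> (0 < k.2)%N) -> sigma_per per A ->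
    P (A `&` \bigcap_(k in [set` J]) [set w | s k.1 k.2 w = b k]) =
      \int[P]_(w in A)
        (\prod_(k <- J) (let e := scheduled_per eavg per pi k.1 k.2 w in
                         if b k then 1 - e else e)%R)%:E.

Fixpoint aoi (n : R) (h0 : 'I_N -> R) (s : 'I_N -> nat -> {RV P >-> bool})
    (i : 'I_N) (t : nat) (w : T) : R :=
  if t is t'.+1 then
    (if s i t w then n else aoi n h0 s i t' w + n)%R
  else h0 i.

Definition mean_aoi (n : R) (h0 : 'I_N -> R)
    (s : 'I_N -> nat -> {RV P >-> bool}) (horizon : nat) : \bar R :=
  'E_P[fun w => ((N%:R * horizon%:R)^-1 *
         \sum_(1 <= t < horizon.+1) \sum_(i < N) aoi n h0 s i t w)%R].

End Channel.

(* Main.v *)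
(** The expected age obeys H(t) = n + e H(t-1) in a slot where the UE attempts
    and H(t) = n + H(t-1) otherwise, so that
      H_i(t) = n \sum_(a < t) e^(A_i]a+1, t]) + h_i(0) e^(A_i]0, t]),
    where A_i]a, b] counts the attempts of UE i in the slots a+1, ..., b.  In a
    window of u slots the A_i sum to l u, whatever the schedule, and by convexity
    of k |-> e^k the sum \sum_i e^(A_i) is least when the A_i differ pairwise by
    at most 1.  Under round-robin the slots telling two given UEs apart are
    attempts of each of them in turn, so every window is balanced and every
    summand in a is optimal.  The initial ages have a vanishing influence for
    e < 1, except that a negative one may matter under a schedule that starves a
    UE; but then its term is outweighed by the first few summands.  For e = 1 all
    schedules have the same expected ages. *)

Require Import Defs.
From mathcomp Require Import measurable_realfun.
From mathcomp Require Import zify ring lra.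

Set Implicit Arguments.
Unset Strict Implicit.
Unset Printing Implicit Defensive.

Local Open Scope classical_set_scope.
Local Open Scope ring_scope.

(** * Attempt counts *)

Section Attempts.
Context (R : realType) (N : nat) (eavg : R).
Implicit Types (pi : blind_schedule R N) (i j : 'I_N) (a b l t u : nat).

(* Slots are numbered from 1: these are the slots [a + 1, ..., b]. *)
Definition attempts pi i a b : nat :=
  (\sum_(a <= v < b) (i \in active eavg pi v.+1))%N.

Lemma attemptsS pi i a b : (a <= b)%N ->
  attempts pi i a b.+1 = (attempts pi i a b + (i \in active eavg pi b.+1))%N.
Proof. by move=> ab; rewrite /attempts big_nat_recr. Qed.

Lemma attempts_mono pi i a b t : (a <= b <= t)%N ->
  (attempts pi i b t <= attempts pi i a t)%N.
Proof.
by move=> /andP[ab bt]; rewrite /attempts (big_cat_nat ab bt) leq_addl.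
Qed.

Lemma sum_attempts l pi a b : cluster_size eavg l pi ->
  (\sum_i attempts pi i a b = (b - a) * l)%N.
Proof.
move=> hpi; rewrite /attempts exchange_big /=.
rewrite -sum_nat_const_nat; apply: eq_bigr => v _.
rewrite -(hpi v.+1)// -sum1_card [RHS]big_mkcond /=.
by apply: eq_bigr => i _; case: (i \in _).
Qed.

(** * Alternation of turns under round-robin *)

Lemma last_attempt_lt pi i t : (0 < t)%N -> (last_attempt eavg pi i t < t)%N.
Proof.
by case: t => // t _; rewrite ltnS; apply/bigmax_leqP => u _; rewrite -ltnS.
Qed.

Lemma leq_last_attempt pi i t u : (0 < u < t)%N -> i \in active eavg pi u ->
  (u <= last_attempt eavg pi i t)%N.
Proof.
move=> /andP[u0 ut] iu.
by apply: (@leq_bigmax_cond _ _ _ (Ordinal ut)); rewrite /= u0.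
Qed.

(** Every attempt of [j] before [t] is matched by one of [i] no earlier: by [u] itself up to slot
    [u], by agreement after it. If [j] were left out at [t], round-robin would force a tie, and the
    turn rule would then require an attempt of [j] at [u]. *)
Lemma turns_alternate l pi i j u t :
  clustered_round_robin eavg l pi -> ties_by_turns eavg pi -> (0 < u < t)%N ->
  i \in active eavg pi u -> j \notin active eavg pi u ->
  (forall v, (u < v < t)%N ->
    (i \in active eavg pi v) = (j \in active eavg pi v)) ->
  i \in active eavg pi t -> j \in active eavg pi t.
Proof.
move=> [_ hrr] hties /andP[u0 ut] iu ju eqv it; apply/negPn/negP => jt.
have t0 : (0 < t)%N by lia.
have lij : (last_attempt eavg pi j t <= last_attempt eavg pi i t)%N.
  apply/bigmax_leqP => -[v vt] /= /andP[v0 jv].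
  have iu_le : (u <= last_attempt eavg pi i t)%N.
    by apply: leq_last_attempt => //; rewrite u0.
  have [vu|uv|vu] := ltngtP v u; first by rewrite (leq_trans (ltnW vu)).
    by apply: leq_last_attempt; rewrite ?v0 // eqv ?uv.
  by rewrite -vu jv in ju.
have lt_i := last_attempt_lt pi i t0; have lt_j := last_attempt_lt pi j t0.
have hij : interval_since_attempt eavg pi i t =
    interval_since_attempt eavg pi j t.
  apply/eqP; rewrite eqn_leq (hrr t i j)// andbT.
  by rewrite /interval_since_attempt leq_sub2l.
have := hties t i j t0 it jt hij u; rewrite u0 ut iu (negbTE ju).
by move=> /(_ isT isT eqv).
Qed.

(** The slots telling [i] and [j] apart alternate between the two, so neither gains a lead of two in
    any window. *)
Lemma round_robin_balanced l pi i j a b :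
  clustered_round_robin eavg l pi -> ties_by_turns eavg pi ->
  (attempts pi i a b <= (attempts pi j a b).+1)%N.
Proof.
move=> hrr hties; have [ba|ab] := ltnP b a.
  by rewrite /attempts big_geq ?(ltnW ba).
(* The induction also carries that, when [i] leads by one, the last slot of the window telling them
   apart was an attempt of [i]; by [turns_alternate], the next such slot cannot be another one. *)
suff [] : (attempts pi i a b <= (attempts pi j a b).+1)%N /\
  (attempts pi i a b = (attempts pi j a b).+1 -> exists2 u, (a <= u < b)%N &
    [/\ i \in active eavg pi u.+1, j \notin active eavg pi u.+1 &
        forall v, (u.+1 < v < b.+1)%N ->
          (i \in active eavg pi v) = (j \in active eavg pi v)]) by [].
rewrite -(subnKC ab); elim: (b - a)%N => [|k [IH1 IH2]].
  by rewrite addn0 /attempts big_geq.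
rewrite addnS !attemptsS ?leq_addr//.
have [ib|ib] := boolP (i \in _); have [jb|jb] := boolP (j \in _);
  rewrite ?addn0 ?addn1.
- split=> // -[] /IH2 [u aub [iu ju eqv]].
  exists u; first lia.
  split=> // v uv; have [->|vb] := eqVneq v (a + k).+1; first by rewrite ib jb.
  by apply: eqv; lia.
- have [e|ne] := eqVneq (attempts pi i a (a + k)) (attempts pi j a (a + k)).+1.
    have [u aub [iu ju eqv]] := IH2 e.
    have := @turns_alternate l pi i j u.+1 (a + k).+1 hrr hties.
    rewrite (negbTE jb) => H; exfalso; suff: false by [].
    by apply: H => //; lia.
  split=> [|_]; first by lia.
  exists (a + k)%N; first lia.
  by split=> // v; lia.
- by split; lia.
- split=> // /IH2 [u aub [iu ju eqv]].
  exists u; first lia.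
  split=> // v uv; have [->|vb] := eqVneq v (a + k).+1.
    by rewrite (negbTE ib) (negbTE jb).
  by apply: eqv; lia.
Qed.

(** Convexity of [k |-> e ^+ k]: the line through its points at [q] and [q.+1] is a minorant at
    every integer. *)
Lemma expr_chord (e : R) (q k : nat) : 0 <= e <= 1 ->
  e ^+ q + (k%:R - q%:R) * (e ^+ q.+1 - e ^+ q) <= e ^+ k.
Proof.
move=> /andP[e0 e1].
have hX m : 0 <= e ^+ m <= 1 by rewrite exprn_ge0//= exprn_ile1.
have [qk|kq] := leqP q k.
  rewrite -(subnKC qk); elim: (k - q)%N => [|m IH].
    by rewrite addn0 subrr mul0r addr0.
  rewrite addnS -[X in X%:R]addn1 natrD [e ^+ (q + m).+1]exprSr.
  rewrite exprSr in IH *.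
  have := hX q; have := hX m; rewrite exprD in IH *.
  move: IH; set x := e ^+ q; set y := e ^+ m; rewrite natrD => IH.
  move=> /andP[y0 y1] /andP[x0 x1].
  (* The excess of the increment of the powers at [q + m] over the slope of the line. *)
  have : 0 <= x * (1 - y) * (1 - e) by rewrite !mulr_ge0 ?subr_ge0.
  by nra.
rewrite -(subnKC (ltnW kq)); elim: (q - k)%N => [|m IH].
  by rewrite addn0 subrr mul0r addr0.
rewrite addnS -[X in _ - X%:R]addn1 natrD.
move: IH; rewrite !exprSr; have := hX (k + m)%N.
set x := e ^+ (k + m); rewrite natrD.
move=> /andP[x0 x1] IH.
(* Here the base point of the line moves right while [k] stays fixed; this is the amount by which
   the value of the line at [k] drops. *)
have : 0 <= x * (1 - e) * (1 - e) * (m%:R + 1).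
  by rewrite !mulr_ge0 ?subr_ge0 ?addr_ge0.
by nra.
Qed.

(** With [q] the minimum of [B], all values of [B] are [q] or [q.+1], where the line of [expr_chord]
    is exact. The sum of an affine function depends on the total only, so it is the same for [A],
    whose powers lie above the line. *)
Lemma balanced_sum_expr_le (e : R) (B A : 'I_N -> nat) : 0 <= e <= 1 ->
  (\sum_i A i = \sum_i B i)%N -> (forall i j, (B i <= (B j).+1)%N) ->
  \sum_i e ^+ B i <= \sum_i e ^+ A i.
Proof.
move=> e01 sAB hB; case: (posnP N) => [N0|N0].
  by rewrite !big1// => -[m mN]; exfalso; rewrite N0 in mN.
have [i0 _ hmin] := @arg_minnP _ (Ordinal N0) xpredT B isT.
set q := B i0; pose c := e ^+ q.+1 - e ^+ q.
have eqB i : e ^+ B i = e ^+ q + ((B i)%:R - q%:R) * c.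
  have := hmin i isT; have := hB i i0; rewrite -/q /c => h1 h2.
  have [->|->] : B i = q \/ B i = q.+1 by lia.
    by rewrite subrr mul0r addr0.
  by rewrite -(natr1 q) [q%:R + 1]addrC addrK mul1r addrC subrK.
rewrite (eq_bigr _ (fun i _ => eqB i)).
suff -> : \sum_i (e ^+ q + ((B i)%:R - q%:R) * c) =
          \sum_i (e ^+ q + ((A i)%:R - q%:R) * c).
  by apply: ler_sum => i _; exact: expr_chord.
rewrite !big_split/= -!mulr_suml !big_split/= -!natr_sum.
by rewrite sAB.
Qed.

End Attempts.

(** * Expectations of bounded random variables *)

Section BoundedExpectation.
Context (R : realType) (d : measure_display) (T : measurableType d)
  (P : probability T R).
Implicit Types (X Y : T -> R).

(** A class of integrable variables closed under sums and products, which settles the integrability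
    conditions below. *)
Definition bounded_measurable X :=
  measurable_fun [set: T] X /\ exists M, forall w, `|X w| <= M.

Lemma bounded_measurable_integrable X : bounded_measurable X ->
  P.-integrable [set: T] (EFin \o X).
Proof.
move=> [mX [M hM]]; apply: measurable_bounded_integrable => //.
  by rewrite (@le_lt_trans _ _ 1%E) ?probability_le1 ?ltry.
exists M; split; first exact: num_real.
by move=> x Mx w _ /=; rewrite (le_trans (hM w)) // ltW.
Qed.

Lemma bounded_expectation X : bounded_measurable X ->
  'E_P[X]%E = (\int[P]_w X w)%:E.
Proof.
move=> bX; rewrite unlock /Rintegral fineK//.
exact/integrable_fin_num/bounded_measurable_integrable.
Qed.

Lemma bounded_measurable_cst c : bounded_measurable (fun=> c).
Proof. by split; [exact: measurable_cst|exists `|c|]. Qed.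

Lemma bounded_measurableD X Y : bounded_measurable X -> bounded_measurable Y ->
  bounded_measurable (fun w => X w + Y w).
Proof.
move=> [mX [M hM]] [mY [M' hM']]; split; first exact: measurable_funD.
by exists (M + M') => w; rewrite (le_trans (ler_normD _ _))// lerD.
Qed.

Lemma bounded_measurableM X Y : bounded_measurable X -> bounded_measurable Y ->
  bounded_measurable (fun w => X w * Y w).
Proof.
move=> [mX [M hM]] [mY [M' hM']]; split; first exact: measurable_funM.
by exists (M * M') => w; rewrite normrM ler_pM.
Qed.

Lemma bounded_measurable_sum (I : Type) (s : seq I) (X : I -> T -> R) :
  (forall i, bounded_measurable (X i)) ->
  bounded_measurable (fun w => \sum_(i <- s) X i w).
Proof.
move=> bX; elim: s => [|i s IH].
  by under eq_fun do rewrite big_nil; exact: bounded_measurable_cst.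
by under eq_fun do rewrite big_cons; exact: bounded_measurableD.
Qed.

Lemma bounded_measurable_prod (I : eqType) (s : seq I) (X : I -> T -> R) :
  {in s, forall i, bounded_measurable (X i)} ->
  bounded_measurable (fun w => \prod_(i <- s) X i w).
Proof.
elim: s => [|i s IH] bX.
  by under eq_fun do rewrite big_nil; exact: bounded_measurable_cst.
under eq_fun do rewrite big_cons; apply: bounded_measurableM.
  by apply: bX; rewrite mem_head.
by apply: IH => j js; apply: bX; rewrite inE js orbT.
Qed.

Lemma bounded_measurable_indic (A : set T) : measurable A ->
  bounded_measurable (\1_A : T -> R).
Proof.
move=> mA; split; first exact: measurable_indic.
by exists 1 => w; rewrite indicE ger0_norm// lern1 leq_b1.
Qed.

Lemma bounded_measurable_unit X : measurable_fun [set: T] X ->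
  (forall w, 0 <= X w <= 1) -> bounded_measurable X.
Proof.
move=> mX X01; split=> //; exists 1 => w.
by have /andP[X0 X1] := X01 w; rewrite ger0_norm.
Qed.

Lemma expectation_bsum (I : Type) (s : seq I) (X : I -> T -> R) :
  (forall i, bounded_measurable (X i)) ->
  \int[P]_w (\sum_(i <- s) X i w) = \sum_(i <- s) \int[P]_w X i w.
Proof.
move=> bX; elim: s => [|i s IH].
  rewrite big_nil; under eq_Rintegral do rewrite big_nil.
  by rewrite Rintegral_cst// mul0r.
rewrite big_cons; under eq_Rintegral do rewrite big_cons.
rewrite RintegralD ?IH//; apply: bounded_measurable_integrable => //.
exact: bounded_measurable_sum.
Qed.

Lemma expectation_bcst (c : R) : \int[P]_w c = c.
Proof.
rewrite Rintegral_cst// -[RHS]mulr1; congr (_ * _).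
exact: (congr1 fine (probability_setT P)).
Qed.

Lemma expectation_norm_le X (M : R) : bounded_measurable X ->
  (forall w, `|X w| <= M) -> `|\int[P]_w X w| <= M.
Proof.
move=> bX hM; apply: le_trans (le_normr_Rintegral _ _) _ => //.
  exact: bounded_measurable_integrable.
have -> : M = \int[P]_w M.
  by rewrite expectation_bcst.
apply: le_Rintegral => //; apply: bounded_measurable_integrable.
  have [mX [M' hM']] := bX; split; first exact: measurableT_comp.
  by exists M' => w; rewrite normr_id.
exact: bounded_measurable_cst.
Qed.

Lemma expectation_bindic (A : set T) : measurable A ->
  \int[P]_w \1_A w = fine (P A).
Proof. by move=> mA; rewrite /Rintegral integral_indic// setIT. Qed.

End BoundedExpectation.

(** * Product rule for expectations by discretization *)

Section Discretization.
Context (R : realType).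

(* [x] rounded down to a multiple of [m.+1%:R^-1], written as a combination of
   indicators so that independence of events applies to it. *)
Definition level m (x : R) : R :=
  m.+1%:R^-1 * \sum_(j < m.+1) (j.+1%:R <= m.+1%:R * x)%R%:R.

Lemma level_approx m (x : R) : 0 <= x <= 1 -> `|x - level m x| <= m.+1%:R^-1.
Proof.
move=> /andP[x0 x1]; set k := Num.truncn (m.+1%:R * x).
have mx0 : 0 <= m.+1%:R * x by rewrite mulr_ge0.
have km : (k <= m.+1)%N.
  by rewrite Num.Theory.truncn_le_nat (le_lt_trans (ler_piMr _ x1))// ltr_nat.
(* The threshold [j.+1] is reached exactly when [j < k], and [x <= 1] keeps [k] within the [m.+1]
   thresholds. *)
have -> : level m x = m.+1%:R^-1 * k%:R.
  congr (_ * _); rewrite -natr_sum; congr (_%:R).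
  transitivity (\sum_(j < m.+1) (j < k : nat))%N.
    by apply: eq_bigr => j _; rewrite /k Num.Theory.truncn_gt_nat.
  rewrite -(subnKC km) big_split_ord /= [X in (_ + X)%N]big1 ?addn0.
    by rewrite (eq_bigr (fun=> 1%N)) ?sum1_card ?card_ord// => -[j /= ->].
  by move=> j _; rewrite ltnNge leq_addr.
have /andP[k1 k2] := Num.Theory.truncn_itv mx0; rewrite -/k in k1 k2.
have m0 : (0 : R) < m.+1%:R by [].
have -> : x - m.+1%:R^-1 * k%:R = m.+1%:R^-1 * (m.+1%:R * x - k%:R).
  by rewrite mulrBr mulKf// gt_eqF.
rewrite ger0_norm ?mulr_ge0 ?subr_ge0 ?invr_ge0//.
rewrite ler_piMr ?invr_ge0// lerBlDl ltW// (lt_le_trans k2)//.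
by rewrite -addn1 natrD.
Qed.

End Discretization.

Section Independence.
Context (R : realType) (d : measure_display) (T : measurableType d)
  (P : probability T R).
Implicit Types (X Y : T -> R).

(** By linearity the rule for events extends to the step functions [level m (X w)], which converge
    uniformly to [X]. *)
Lemma expectation_mul_indep X Y :
  measurable_fun [set: T] X -> (forall w, 0 <= X w <= 1) ->
  measurable_fun [set: T] Y -> (forall w, 0 <= Y w <= 1) ->
  (forall B, measurable B ->
    \int[P]_w (\1_(X @^-1` B) w * Y w) =
    fine (P (X @^-1` B)) * \int[P]_w Y w) ->
  \int[P]_w (X w * Y w) = \int[P]_w X w * \int[P]_w Y w.
Proof.
move=> mX X01 mY Y01 hXY.
have bX := bounded_measurable_unit mX X01.
have bY := bounded_measurable_unit mY Y01.
pose B m (j : 'I_m.+1) := [set x : R | j.+1%:R <= m.+1%:R * x].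
have mB m j : measurable (@B m j).
  rewrite (_ : @B m j = `[m.+1%:R^-1 * j.+1%:R, +oo[%classic)//.
  by apply/seteqP; split=> x /=; rewrite /B /= in_itv /= andbT ler_pdivrMl.
have mXB m j : measurable (X @^-1` @B m j).
  by rewrite -[X in measurable X]setTI; apply: mX => //; exact: mB.
have levelE m w : level m (X w) =
    m.+1%:R^-1 * \sum_(j < m.+1) \1_(X @^-1` B m j) w.
  congr (_ * _); apply: eq_bigr => j _; rewrite indicE.
  by congr ((nat_of_bool _)%:R); apply/idP/idP; rewrite ?inE.
have b1 m j := bounded_measurable_indic R (mXB m j).
have bs m :
    bounded_measurable (fun w => \sum_(j < m.+1) \1_(X @^-1` B m j) w : R).
  by apply: bounded_measurable_sum => j.
have bl m : bounded_measurable (fun w => level m (X w)).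
  under eq_fun do rewrite levelE.
  by apply: bounded_measurableM => //; exact: bounded_measurable_cst.
have hl m : \int[P]_w (level m (X w) * Y w) =
    \int[P]_w level m (X w) * \int[P]_w Y w.
  under eq_Rintegral do rewrite levelE -mulrA mulr_suml.
  under [in RHS]eq_Rintegral do rewrite levelE.
  have b1Y j : bounded_measurable (fun w => \1_(X @^-1` B m j) w * Y w).
    exact: bounded_measurableM.
  rewrite !RintegralZl//; [|exact: bounded_measurable_integrable
    |exact/bounded_measurable_integrable/bounded_measurable_sum].
  rewrite !expectation_bsum// -mulrA mulr_suml; congr (_ * _).
  by apply: eq_bigr => j _; rewrite hXY ?expectation_bindic.
have bYN : bounded_measurable (fun w => - Y w).
  under eq_fun do rewrite -mulN1r.
  by apply: bounded_measurableM => //; exact: bounded_measurable_cst.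
have b_sub m : bounded_measurable (fun w => X w - level m (X w)).
  under eq_fun do rewrite -mulN1r.
  apply: bounded_measurableD => //; apply: bounded_measurableM => //.
  exact: bounded_measurable_cst.
set a := LHS; set b := RHS.
have int X' : bounded_measurable X' -> P.-integrable [set: T] (EFin \o X').
  exact: bounded_measurable_integrable.
(* Replacing [X] by its discretization costs at most [m.+1%:R^-1] on each side, since [Y] is at most
   1. *)
have close m : `|a - b| <= 2 * m.+1%:R^-1.
  have -> : a - b = \int[P]_w ((X w - level m (X w)) * Y w) -
      \int[P]_w (X w - level m (X w)) * \int[P]_w Y w.
    rewrite RintegralB ?mulrBl ?int// -hl.
    under [in RHS]eq_Rintegral do rewrite mulrBl.
    rewrite RintegralB ?int//; try exact: bounded_measurableM.
    by rewrite /a /b opprB addrA subrK.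
  rewrite mulr2n mulrDl mul1r (le_trans (ler_normB _ _))// lerD//.
    apply: expectation_norm_le; first exact: bounded_measurableM.
    move=> w; rewrite normrM -[leRHS]mulr1 ler_pM ?level_approx//.
    by have /andP[Y0 Y1] := Y01 w; rewrite ger0_norm.
  rewrite normrM -[leRHS]mulr1 ler_pM ?level_approx//.
    by apply: expectation_norm_le => // w; exact: level_approx.
  apply: expectation_norm_le => // w.
  by have /andP[Y0 Y1] := Y01 w; rewrite ger0_norm.
apply/eqP; rewrite -subr_eq0 -normr_le0 leNgt; apply/negP => ab0.
have := close (Num.truncn (2 / `|a - b|)).
rewrite leNgt => /negP; apply; rewrite ltr_pdivrMr//.
rewrite mulrC -ltr_pdivrMr//; exact: Num.Theory.truncnS_gt.
Qed.

End Independence.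

(** * Expected ages *)

Section Channel.
Context (R : realType) (N : nat) (d : measure_display) (T : measurableType d)
  (P : probability T R) (eavg : R) (per : 'I_N -> nat -> {RV P >-> R}).
Hypothesis hper : iid_per eavg per.
Implicit Types (i : 'I_N) (a b t u : nat) (J : seq ('I_N * nat)).

Let slot (k : 'I_N * nat) := (0 < k.2)%N.

Lemma per_preimage_measurable i t (B : set R) : measurable B ->
  measurable (per i t @^-1` B).
Proof.
by move=> mB; rewrite -[X in measurable X]setTI; exact: measurable_funP.
Qed.

Lemma prod_indic (I : eqType) (s : seq I) (A : I -> set T) w :
  \prod_(k <- s) \1_(A k) w = \1_(\bigcap_(k in [set` s]) A k) w :> R.
Proof.
elim: s => [|k s IH]; rewrite ?big_nil ?big_cons.
  by rewrite indicE mem_set// => k.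
rewrite IH !indicE -natrM mulnb; congr ((nat_of_bool _)%:R).
apply/andP/idP => [[/set_mem Ak /set_mem As]|/set_mem As].
  apply/mem_set => j /=; rewrite inE => /predU1P[->//|js]; exact: As.
split; apply/mem_set; first by apply: As; rewrite /= mem_head.
by move=> j js; apply: As; rewrite /= inE js orbT.
Qed.

(** The indicators make the induction on [J] work: to split off the PER of [k], its independence
    from the other factors is tested on an event about that PER, which is the induction hypothesis
    with [k] moved to the indicator side. The base case is mutual independence. *)
Lemma expectation_prod_per_indic J J' (B : 'I_N * nat -> set R) :
  uniq (J ++ J') -> all slot (J ++ J') -> (forall k, measurable (B k)) ->
  \int[P]_w (\prod_(k <- J) per k.1 k.2 w *
             \prod_(k <- J') \1_(per k.1 k.2 @^-1` B k) w) =
  eavg ^+ size J * \prod_(k <- J') fine (P (per k.1 k.2 @^-1` B k)).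
Proof.
have [per01 indep _ Eper] := hper.
elim: J J' B => [|k J IH] J' B /=.
  move=> uJ /allP sJ mB; rewrite expr0 mul1r.
  under eq_Rintegral do rewrite big_nil mul1r prod_indic.
  rewrite expectation_bindic; last first.
    apply: fin_bigcap_measurable => [|k _]; first exact: finite_seq.
    exact: per_preimage_measurable.
  rewrite indep// -[RHS]/(fine (EFin _)) -prodEFin; congr fine.
  apply: eq_bigr => k _; rewrite fineK// fin_num_measure//.
  exact: per_preimage_measurable.
move=> /andP[kJ uJ] /andP[k0 sJ] mB.
have mk : measurable_fun [set: T] (per k.1 k.2) by exact: measurable_funPT.
have p01 : {in J, forall j w, 0 <= per j.1 j.2 w <= 1}.
  move=> j jJ w; apply: per01; apply: (allP sJ j).
  by rewrite mem_cat jJ.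
pose Y w := \prod_(k <- J) per k.1 k.2 w *
            \prod_(k <- J') (\1_(per k.1 k.2 @^-1` B k) w : R).
have mY : measurable_fun [set: T] Y.
  apply: measurable_funM; apply: measurable_prod => j jJ.
    exact: measurable_funPT.
  by apply: measurable_indic; exact: per_preimage_measurable.
have Y01 w : 0 <= Y w <= 1.
  rewrite /Y big_seq; apply/andP; split.
    rewrite mulr_ge0// ?prodr_ge0// => j jJ.
    by have /andP[] := p01 j jJ w.
  rewrite mulr_ile1 ?prodr_ge0 ?prodr_ile1//.
  - by move=> j jJ; have /andP[] := p01 j jJ w.
  - by move=> j jJ; exact: p01.
  - by move=> j _; rewrite indicE ler0n lern1 leq_b1.
have -> : \int[P]_w (\prod_(k0 <- k :: J) per k0.1 k0.2 w *
    \prod_(k0 <- J') \1_(per k0.1 k0.2 @^-1` B k0) w) =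
    \int[P]_w (per k.1 k.2 w * Y w).
  by apply: eq_Rintegral => w _; rewrite big_cons mulrA.
rewrite (@expectation_mul_indep _ _ _ _ (per k.1 k.2) Y)//.
- rewrite /Y IH// exprS -mulrA; congr (_ * _).
  have := Eper k.1 k.2 k0; rewrite bounded_expectation; first by move=> [].
  by apply: bounded_measurable_unit => // w; exact: per01.
- by move=> w; exact: per01.
(* Since [k] is not in [J'], imposing [C] at [k] leaves the other events unchanged. *)
move=> C mC; pose B' j := if j == k then C else B j.
have eqB j : j \in J' -> B' j = B j.
  rewrite /B'; case: eqP => // -> kJ'.
  by rewrite mem_cat kJ' orbT in kJ.
have B'k : B' k = C by rewrite /B' eqxx.
have := IH (k :: J') B'; rewrite big_cons B'k.
rewrite [X in _ * (_ * X)](_ : _ =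
    \prod_(j <- J') fine (P (per j.1 j.2 @^-1` B j))); last first.
  by apply: eq_big_seq => j /eqB /= ->.
rewrite mulrCA -(IH J' B)// => <-//.
- apply: eq_Rintegral => w _; rewrite /Y big_cons B'k mulrCA.
  congr (_ * (_ * _)).
  by apply: eq_big_seq => j jJ'; rewrite eqB.
- by rewrite uniq_catC /= mem_cat orbC -mem_cat kJ uniq_catC.
- by move: sJ; rewrite !all_cat /= k0 => /andP[-> ->].
- by move=> j; rewrite /B'; case: ifP.
Qed.

Lemma expectation_prod_per J : uniq J -> all slot J ->
  \int[P]_w (\prod_(k <- J) per k.1 k.2 w) = eavg ^+ size J.
Proof.
move=> uJ sJ; have := @expectation_prod_per_indic J [::] (fun=> setT).
rewrite !cats0 big_nil mulr1 => <-//.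
by apply: eq_Rintegral => w _; rewrite big_nil mulr1.
Qed.

Lemma eavg_ge0_le1 : (0 < N)%N -> 0 <= eavg <= 1.
Proof.
move=> N0; have [per01 _ _ Eper] := hper.
have := Eper (Ordinal N0) 1%N isT; set X := per _ _.
have X01 w : 0 <= X w <= 1 by exact: per01.
have bX : bounded_measurable X.
  by apply: bounded_measurable_unit => //; exact: measurable_funPT.
rewrite bounded_expectation// => -[<-]; apply/andP; split.
  by apply: Rintegral_ge0 => w _; have /andP[] := X01 w.
rewrite (le_trans (ler_norm _))//; apply: expectation_norm_le => // w.
by have /andP[X0 X1] := X01 w; rewrite ger0_norm.
Qed.

(** * Runs of failures and the age recursion *)

Context (pi : blind_schedule R N) (s : 'I_N -> nat -> {RV P >-> bool}).
Hypothesis hs : success_indicators eavg per pi s.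

Let fail i t w : R := (~~ s i t w)%:R.

Lemma fail_measurable i t : measurable [set w | s i t w = false].
Proof.
have : measurable ([set: T] `&` s i t @^-1` [set false]).
  exact: measurable_funPT.
by rewrite setTI.
Qed.

Lemma bounded_measurable_fail i t : bounded_measurable (fail i t).
Proof.
rewrite (_ : fail i t = \1_[set w | s i t w = false]).
  exact/bounded_measurable_indic/fail_measurable.
apply/funext => w; rewrite indicE /fail; congr ((nat_of_bool _)%:R).
by apply/idP/idP => [/negbTE ?|/set_mem /= ->//]; apply/mem_set.
Qed.

(** Given the PERs, failure throughout the window has as probability the product of the scheduled
    PERs. Slots without an attempt contribute 1. As the schedule is blind, the remaining slots are a
    fixed set of independent PERs, each of mean [eavg]. *)
Lemma expectation_prod_fail i a b :
  \int[P]_w (\prod_(a <= v < b) fail i v.+1 w) =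
  eavg ^+ attempts eavg pi i a b.
Proof.
have [per01 _ _ _] := hper.
pose J := [seq (i, v.+1) | v <- index_iota a b].
have uJ : uniq J by rewrite map_inj_uniq ?iota_uniq// => u v [].
have sJ : all slot J by apply/allP => _ /mapP[v _ ->].
(* The defining property of the indicators is used on the whole space, the complement of the empty
   set. *)
have Tsigma : sigma_per per [set: T].
  by move=> M [[M0 MD _] _]; rewrite -(setD0 setT); exact: MD.
have -> : \int[P]_w (\prod_(a <= v < b) fail i v.+1 w) =
    fine (P ([set: T] `&`
             \bigcap_(k in [set` J]) [set w | s k.1 k.2 w = false])).
  rewrite setTI -expectation_bindic; last first.
    apply: fin_bigcap_measurable => [|k _]; first exact: finite_seq.
    exact: fail_measurable.
  apply: eq_Rintegral => w _; rewrite -prod_indic big_map.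
  apply: eq_bigr => v _; rewrite indicE; congr ((nat_of_bool _)%:R).
  by apply/idP/idP => [/negbTE ?|/set_mem /= ->//]; apply/mem_set.
have -> := hs (fun=> false) uJ (allP sJ) Tsigma.
pose J' := [seq k <- J | k.1 \in active eavg pi k.2].
transitivity (\int[P]_w (\prod_(k <- J') per k.1 k.2 w)).
  apply: eq_Rintegral => w _ /=.
  rewrite big_filter [RHS]big_mkcond /=.
  by apply: eq_bigr => k _; rewrite /scheduled_per.
rewrite expectation_prod_per ?filter_uniq//; last first.
  by apply/allP => k; rewrite mem_filter => /andP[_]; exact: (allP sJ).
congr (_ ^+ _); rewrite size_filter count_map /attempts.
by rewrite -sum1_count big_mkcond; apply: eq_bigr => v _ /=; case: (i \in _).
Qed.

Context (n : R) (h0 : 'I_N -> R).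

(** The [n] accrued in slot [a.+1] is still counted at [t] exactly when all later slots fail; a
    success in slot [a.+1] itself does not remove it. The initial age survives only if every slot
    fails. *)
Lemma aoiE i t w : aoi n h0 s i t w =
  n * \sum_(a < t) \prod_(a.+1 <= v < t) fail i v.+1 w +
  h0 i * \prod_(0 <= v < t) fail i v.+1 w.
Proof.
elim: t => [|t IH] /=; first by rewrite big_ord0 big_geq// mulr0 add0r mulr1.
have prodS a : (a <= t)%N -> \prod_(a <= v < t.+1) fail i v.+1 w =
    \prod_(a <= v < t) fail i v.+1 w * fail i t.+1 w.
  by move=> at_; rewrite big_nat_recr.
rewrite big_ord_recr /= [\prod_(t.+1 <= _ < t.+1) _]big_geq// prodS//.
under eq_bigr => a _ do rewrite prodS//.
rewrite -mulr_suml /fail; case: (s i t.+1 w) => /=.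
  by rewrite !mulr0 addr0 add0r mulr1.
by rewrite IH !mulr1; ring.
Qed.

Definition expected_aoi i t : R :=
  n * \sum_(a < t) eavg ^+ attempts eavg pi i a.+1 t +
  h0 i * eavg ^+ attempts eavg pi i 0 t.

Lemma bounded_measurable_prod_fail i a t :
  bounded_measurable (fun w => \prod_(a <= v < t) fail i v.+1 w).
Proof.
by apply: bounded_measurable_prod => v _; exact: bounded_measurable_fail.
Qed.

Lemma bounded_measurable_aoi i t : bounded_measurable (aoi n h0 s i t).
Proof.
rewrite (funext (aoiE i t)).
apply: bounded_measurableD; apply: bounded_measurableM;
  (try exact: bounded_measurable_cst); last exact: bounded_measurable_prod_fail.
by apply: bounded_measurable_sum => a; exact: bounded_measurable_prod_fail.
Qed.

Lemma expectation_aoi i t : \int[P]_w aoi n h0 s i t w = expected_aoi i t.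
Proof.
have bp := bounded_measurable_prod_fail.
have bs : bounded_measurable
    (fun w => \sum_(a < t) \prod_(a.+1 <= v < t) fail i v.+1 w).
  by apply: bounded_measurable_sum => a.
have bc c := @bounded_measurable_cst R d T c.
under eq_Rintegral do rewrite aoiE.
rewrite RintegralD//; try (apply: bounded_measurable_integrable;
  exact: bounded_measurableM).
rewrite !RintegralZl//; try exact: bounded_measurable_integrable.
rewrite expectation_bsum//= /expected_aoi !expectation_prod_fail.
by under eq_bigr do rewrite expectation_prod_fail.
Qed.

Lemma mean_aoiE t : mean_aoi n h0 s t =
  ((N%:R * t%:R)^-1 * \sum_(1 <= u < t.+1) \sum_i expected_aoi i u)%:E.
Proof.
have bsi u : bounded_measurable (fun w => \sum_i aoi n h0 s i u w).
  by apply: bounded_measurable_sum => i; exact: bounded_measurable_aoi.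
have bs : bounded_measurable
    (fun w => \sum_(1 <= u < t.+1) \sum_i aoi n h0 s i u w).
  exact: bounded_measurable_sum.
rewrite /mean_aoi bounded_expectation; last first.
  by apply: bounded_measurableM => //; exact: bounded_measurable_cst.
rewrite RintegralZl//; last exact: bounded_measurable_integrable.
rewrite expectation_bsum//; congr (_ * _)%:E; apply: eq_bigr => u _.
rewrite expectation_bsum; last by move=> i; exact: bounded_measurable_aoi.
by apply: eq_bigr => i _; rewrite expectation_aoi.
Qed.

End Channel.

(** * Time averages *)

Section TimeAverage.
Context (R : realType) (N : nat).
Implicit Types (u v x y M : nat -> R) (t : nat).

(** The factor [N] makes this an average per UE when [u k] is a total over the UEs. *)
Definition time_average u t : R :=
  (N%:R * t%:R)^-1 * \sum_(1 <= k < t.+1) u k.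

Lemma time_averageS u t :
  time_average u t.+1 = N%:R^-1 * arithmetic_mean (fun k => u k.+1) t.
Proof.
rewrite /time_average /arithmetic_mean /= seriesEnat /= invfM -mulrA.
by rewrite (big_addn 0 t.+2 1) subn1; under eq_bigr do rewrite addn1.
Qed.

Lemma time_averageD u v t :
  time_average (fun k => u k + v k) t = time_average u t + time_average v t.
Proof. by rewrite /time_average big_split mulrDr. Qed.

Lemma le_time_average u v t : (forall k, (0 < k)%N -> u k <= v k) ->
  time_average u t <= time_average v t.
Proof.
move=> uv; rewrite /time_average ler_wpM2l ?invr_ge0 ?mulr_ge0//.
by apply: ler_sum_nat => k /andP[k0 _]; exact: uv.
Qed.

(** Each new term dominates all earlier ones, so it cannot lower the average; at [t = 0] the average
    is an empty sum, hence 0. *)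
Lemma time_average_nondecreasing u : nondecreasing_seq u -> 0 <= u 0%N ->
  nondecreasing_seq (time_average u).
Proof.
move=> uS u0; apply/nondecreasing_seqP => -[|t].
  rewrite /time_average big_nil mulr0 big_nat1 mulr_ge0 ?invr_ge0 ?mulr_ge0//.
  by rewrite (le_trans u0)// uS.
rewrite /time_average !invfM -!mulrA ler_wpM2l ?invr_ge0//.
rewrite [in leRHS]big_nat_recr //=; set S := \sum_(_ <= _ < _) _.
have hS : S <= t.+1%:R * u t.+2.
  rewrite (_ : _ * _ = \sum_(1 <= k < t.+2) u t.+2); last first.
    by rewrite sumr_const_nat subSS subn0 mulr_natl.
  apply: ler_sum_nat => k /andP[_ kt].
  by apply: uS; rewrite ltnW.
rewrite ler_pdivrMl// mulrCA ler_pdivlMl// -[t.+2%:R]natr1.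
by rewrite mulrDl mul1r mulrDr lerD2l.
Qed.

Lemma cvg_time_average u (c : R) : u @ \oo --> c ->
  time_average u @ \oo --> N%:R^-1 * c.
Proof.
move=> uc; rewrite -cvg_shiftS.
rewrite (_ : [sequence _]_n =
    fun t => N%:R^-1 * arithmetic_mean (fun k => u k.+1) t).
  by apply: cvgMr; apply: cesaro; rewrite cvg_shiftS.
by apply/funext => t; exact: time_averageS.
Qed.

Lemma limn_einf_ge (w z : (\bar R)^nat) c :
  (forall t, w t <= z t)%E -> w @ \oo --> c -> (c <= limn_einf z)%E.
Proof.
move=> wz wc; have [<- _] := cvg_limn_einf_sup wc.
rewrite !limn_einf_lim; apply: lee_lim; [exact: is_cvg_einfs..|].
apply: nearW => t; apply: le_ereal_inf_tmp => _ [k /= tk] <-.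
by apply: le_trans (wz k); apply: ereal_inf_lbound; exists k.
Qed.

(** The common part [M] may diverge, but its averages are monotone and so have an extended limit.
    The corrections [x] and [y] shift that limit by the same finite amount; [v] itself need not have
    converging averages. *)
Lemma limn_esup_le_einf_time_average u v M x y (c : R) :
  nondecreasing_seq M -> 0 <= M 0%N ->
  (forall k, (0 < k)%N -> u k = M k + x k) ->
  (forall k, (0 < k)%N -> M k + y k <= v k) ->
  x @ \oo --> c -> y @ \oo --> c ->
  (limn_esup (fun t => (time_average u t)%:E) <=
   limn_einf (fun t => (time_average v t)%:E))%E.
Proof.
move=> Mnd M0 uM vM xc yc.
have [L ML] : exists L, (fun t => (time_average M t)%:E) @ \oo --> (L : \bar R).
  apply/cvg_ex/ereal_nondecreasing_is_cvgn => a b ab.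
  by rewrite lee_fin time_average_nondecreasing.
have MxL z : z @ \oo --> c ->
    (fun t => (time_average (fun k => M k + z k) t)%:E) @ \oo -->
    (L + (N%:R^-1 * c)%:E)%E.
  move=> zc; under eq_fun do rewrite time_averageD EFinD.
  apply: cvgeD => //; first by rewrite fin_num_adde_defl.
  by apply: cvg_EFin; [exact: nearW|exact: cvg_time_average].
have -> : limn_esup (fun t => (time_average u t)%:E) = (L + (N%:R^-1 * c)%:E)%E.
  have [_ <-] := cvg_limn_einf_sup (MxL x xc); congr limn_esup.
  apply/funext => t; congr (_)%:E; apply/eqP; rewrite eq_le.
  by rewrite !le_time_average// => k k0; rewrite uM.
apply: limn_einf_ge (MxL y yc) => t.
by rewrite lee_fin le_time_average.
Qed.

End TimeAverage.

(** * Optimality *)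

Lemma cvg_sum0 (R : realType) (I : finType) (x : I -> nat -> R) :
  (forall i, x i @ \oo --> (0 : R)) ->
  (fun t => \sum_i x i t) @ \oo --> (0 : R).
Proof.
move=> x0.
suff : (fun t => \sum_i x i t) @ \oo --> \sum_(i : I) (0 : R) by rewrite big1.
by apply: cvg_big => [|i _]; [exact: add_continuous|exact: x0].
Qed.

Section RoundRobinOptimality.
Context (R : realType) (N l : nat) (e n : R) (h0 : 'I_N -> R).
Context (rr pi : blind_schedule R N).
Hypotheses (hl : (0 < l <= N)%N) (e01 : 0 <= e <= 1) (hn : 0 < n).
Hypotheses (hrr : clustered_round_robin e l rr) (hties : ties_by_turns e rr).
Hypothesis hpi : cluster_size e l pi.
Implicit Types (i j : 'I_N) (a b t u m : nat).

(* The least possible value of [\sum_i e ^+ A_i] over the attempt counts [A] of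
   a window of [u] slots. *)
Definition round_robin_sum u : R := \sum_i e ^+ attempts e rr i 0 u.

(** The total expected age of round-robin after [t] slots if all initial ages were zero. *)
Definition cumulated_sum t : R := n * \sum_(a < t) round_robin_sum a.

Let e_ge0 : 0 <= e. Proof. by case/andP: e01. Qed.
Let e_le1 : e <= 1. Proof. by case/andP: e01. Qed.

(** Windows of equal length are both balanced with the same total, so each sum bounds the other. *)
Lemma round_robin_sum_window a b :
  \sum_i e ^+ attempts e rr i a b = round_robin_sum (b - a).
Proof.
have [crr _] := hrr.
have bal a' b' i j := @round_robin_balanced R N e l rr i j a' b' hrr hties.
apply/eqP; rewrite eq_le; apply/andP; split; apply: balanced_sum_expr_le => //;
  by rewrite !(@sum_attempts _ _ _ l)// subn0.
Qed.

Lemma round_robin_sum_le a b :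
  round_robin_sum (b - a) <= \sum_i e ^+ attempts e pi i a b.
Proof.
have [crr _] := hrr.
apply: balanced_sum_expr_le => //; last first.
  by move=> i j; exact: round_robin_balanced hrr hties.
by rewrite !(@sum_attempts _ _ _ l)// subn0.
Qed.

Lemma round_robin_sum_ge0 u : 0 <= round_robin_sum u.
Proof. by apply: sumr_ge0 => i _; rewrite exprn_ge0. Qed.

Lemma cumulated_sum_nondecreasing : nondecreasing_seq cumulated_sum.
Proof.
apply/nondecreasing_seqP => t.
rewrite /cumulated_sum big_ord_recr /= mulrDr lerDl mulr_ge0 ?(ltW hn)//.
exact: round_robin_sum_ge0.
Qed.

Lemma sum_expected_aoi_round_robin t :
  \sum_i expected_aoi e rr n h0 i t =
  cumulated_sum t + \sum_i h0 i * e ^+ attempts e rr i 0 t.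
Proof.
rewrite big_split /= -mulr_sumr exchange_big /=; congr (_ * _ + _).
(* Reversal pairs the window that follows slot [a.+1] with its length [t - a.+1]. *)
rewrite [RHS](reindex_inj rev_ord_inj) /=.
by apply: eq_bigr => a _; exact: round_robin_sum_window.
Qed.

(* With [m] large enough, the ages gained in the first [m] slots outweigh the
   possibly negative initial ages. *)
Lemma sum_expected_aoi_ge m k : (forall i, - h0 i <= n * m%:R) ->
  cumulated_sum k <= \sum_i expected_aoi e pi n h0 i (m + k).
Proof.
move=> hm.
(* Only the [k] shortest windows are kept; their lengths are those summed in [cumulated_sum k]. *)
apply: (@le_trans _ _ (\sum_i n * \sum_(a < k)
    e ^+ attempts e pi i (m + a).+1 (m + k))).
  rewrite -mulr_sumr exchange_big /cumulated_sum ler_wpM2l ?(ltW hn)//=.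
  rewrite [leLHS](reindex_inj rev_ord_inj) /=; apply: ler_sum => a _.
  apply: le_trans (round_robin_sum_le _ _).
  by rewrite -addnS subnDl.
apply: ler_sum => i _; rewrite /expected_aoi big_split_ord /= mulrDr.
rewrite addrAC lerDr; set E := e ^+ _.
have E0 : 0 <= E by rewrite exprn_ge0.
(* Each of the [m] longest windows lies within the whole one, so its power of [e] is at least [E];
   together they contribute at least [n * m%:R * E]. *)
apply: (@le_trans _ _ ((n * m%:R + h0 i) * E)).
  by rewrite mulr_ge0// -lerBlDr sub0r.
rewrite mulrDl lerD2r -mulrA ler_wpM2l ?(ltW hn)//.
rewrite (_ : m%:R * E = \sum_(a < m) E); last first.
  by rewrite sumr_const card_ord mulr_natl.
apply: ler_sum => a _.
by rewrite ler_wiXn2l// attempts_mono// ltn_addr.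
Qed.

(** At least [u] attempts are made in [u] slots, and no UE is more than one attempt ahead of [i];
    hence [N] times the count of [i] plus one is at least [u]. *)
Lemma attempts_round_robin_ge i u :
  ((u %/ N).-1 <= attempts e rr i 0 u)%N.
Proof.
have [crr _] := hrr; have /andP[l0 lN] := hl.
have := sum_attempts 0 u crr; rewrite subn0 => hs.
have : (u <= N * (attempts e rr i 0 u).+1)%N.
  rewrite (leq_trans (leq_pmulr u l0))// -hs.
  rewrite (leq_trans (n := (\sum_(j < N) (attempts e rr i 0 u).+1)%N))//.
    by apply: leq_sum => j _; exact: round_robin_balanced hrr hties.
  by rewrite sum_nat_const card_ord.
move=> /(leq_div2r N); rewrite mulKn; last exact: leq_trans lN.
by case: (u %/ N)%N.
Qed.

Lemma expr_attempts_round_robin_cvg0 i : e < 1 ->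
  (fun u => e ^+ attempts e rr i 0 u) @ \oo --> (0 : R).
Proof.
move=> e1; have /andP[l0 lN] := hl; have N0 : (0 < N)%N := leq_trans l0 lN.
have eX0 : (fun k => e ^+ k) @ \oo --> (0 : R).
  by apply: cvg_expr; rewrite ger0_norm.
apply/cvgrPdist_lt => eps eps0.
move/cvgrPdist_lt : eX0 => /(_ eps eps0)[K _ hK].
(* From there on [u %/ N] is at least [K.+1], which absorbs the predecessor in the lower bound. *)
exists (K.+1 * N)%N => // u /= Ku; apply: hK => /=.
apply: leq_trans (attempts_round_robin_ge i u).
by rewrite -[K]/(K.+1.-1) -!subn1 leq_sub2r// leq_divRL.
Qed.

Lemma round_robin_sum_cvg0 : e < 1 -> round_robin_sum @ \oo --> (0 : R).
Proof.
by move=> e1; apply: cvg_sum0 => i; exact: expr_attempts_round_robin_cvg0.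
Qed.

Lemma clustered_round_robin_optimal :
  (limn_esup (fun t => (time_average N
     (fun u => \sum_i expected_aoi e rr n h0 i u) t)%:E) <=
   limn_einf (fun t => (time_average N
     (fun u => \sum_i expected_aoi e pi n h0 i u) t)%:E))%E.
Proof.
have M0 : 0 <= cumulated_sum 0 by rewrite /cumulated_sum big_ord0 mulr0.
have M_nd := cumulated_sum_nondecreasing.
(* For [e = 1] no power decays: [cumulated_sum] grows linearly, and the initial ages remain as the
   common constant. *)
have [e1|e1] := eqVneq e 1.
  apply: (@limn_esup_le_einf_time_average _ _ _ _ cumulated_sum
    (fun=> \sum_i h0 i) (fun=> \sum_i h0 i) (\sum_i h0 i)) => //;
    [move=> k _|move=> k _|exact: cvg_cst|exact: cvg_cst].
    rewrite sum_expected_aoi_round_robin; congr (_ + _).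
    by apply: eq_bigr => i _; rewrite e1 expr1n mulr1.
  have -> : \sum_i expected_aoi e pi n h0 i k =
      \sum_i expected_aoi e rr n h0 i k.
    apply: eq_bigr => i _; rewrite /expected_aoi e1 !expr1n.
    by congr (_ * _ + _); apply: eq_bigr => a _; rewrite !expr1n.
  rewrite sum_expected_aoi_round_robin lerD2l.
  by apply: ler_sum => i _; rewrite e1 expr1n mulr1.
have {}e1 : e < 1 by rewrite lt_neqAle e1.
have [m hm] : exists m : nat, forall i, - h0 i <= n * m%:R.
  (* Summing over all UEs gives one bound valid for each of them. *)
  exists (Num.truncn (\sum_i `|h0 i| / n)).+1 => i.
  rewrite -ler_pdivrMl// ltW// (le_lt_trans _ (Num.Theory.truncnS_gt _))//.
  rewrite (bigD1 i)//= mulrC -[leLHS]addr0 lerD//.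
    by rewrite ler_pM2r ?invr_gt0// -normrN ler_norm.
  by apply: sumr_ge0 => j _; rewrite divr_ge0// ltW.
(* The first [m] values are exact and do not affect the limit. From [m] on, [y t] is
   [cumulated_sum (t - m) - cumulated_sum t], made of [m] values of [round_robin_sum], which tend to
   0. *)
pose y t := if (t < m)%N
  then \sum_i expected_aoi e pi n h0 i t - cumulated_sum t
  else - (n * \sum_(j < m) round_robin_sum (t - m + j)).
apply: (@limn_esup_le_einf_time_average _ _ _ _ cumulated_sum
  (fun t => \sum_i h0 i * e ^+ attempts e rr i 0 t) y 0) => //.
- by move=> k _; exact: sum_expected_aoi_round_robin.
- move=> k _; rewrite /y; case: ltnP => [_|mk]; first by rewrite addrC subrK.
  apply: le_trans (_ : cumulated_sum (k - m) <= _); last first.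
    by have := sum_expected_aoi_ge (k - m) hm; rewrite subnKC.
  by rewrite lerBlDr -mulrDr -{1}(subnK mk) /cumulated_sum big_split_ord.
- apply: cvg_sum0 => i; rewrite -[X in _ --> X](mulr0 (h0 i)).
  by apply: cvgMr; exact: expr_attempts_round_robin_cvg0.
- rewrite -(cvg_shiftn m).
  rewrite (_ : [sequence _]_n =
      fun t => - (n * \sum_(j < m) round_robin_sum (t + j)));
    last by apply/funext => t /=; rewrite /y ltnNge leq_addl addnK.
  suff : (fun t => - (n * \sum_(j < m) round_robin_sum (t + j))) @ \oo -->
      - (n * 0) by rewrite mulr0 oppr0.
  apply: cvgN; apply: cvgMr.
  apply: cvg_sum0 => j; have := round_robin_sum_cvg0 e1.
  by rewrite -(cvg_shiftn j).
Qed.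

End RoundRobinOptimality.

Theorem corollary1 (R : realType) (N l : nat) (hl : (0 < l <= N)%N)
  (n : R) (hn : 0 < n) (h0 : 'I_N -> R)
  (d : measure_display) (T : measurableType d) (P : probability T R)
  (eavg : R) (per : 'I_N -> nat -> {RV P >-> R}) (hper : iid_per eavg per)
  (rr : blind_schedule R N) (s_rr : 'I_N -> nat -> {RV P >-> bool})
  (hrr : clustered_round_robin eavg l rr) (hties : ties_by_turns eavg rr)
  (hs_rr : success_indicators eavg per rr s_rr)
  (pi : blind_schedule R N) (s_pi : 'I_N -> nat -> {RV P >-> bool})
  (hpi : cluster_size eavg l pi)
  (hs_pi : success_indicators eavg per pi s_pi) :
  (limn_esup (mean_aoi n h0 s_rr) <= limn_einf (mean_aoi n h0 s_pi))%E.
Proof.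
have N0 : (0 < N)%N by case/andP: hl => l0; exact: leq_trans.
have e01 := eavg_ge0_le1 hper N0.
rewrite (funext (mean_aoiE hper hs_rr n h0))
  (funext (mean_aoiE hper hs_pi n h0)).
exact: (clustered_round_robin_optimal h0 hl e01 hn hrr hties hpi).
Qed.
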